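(* For the Hadamard walk on $\mathbb{Z}$, let $p^0_n(k), q^0_n(k), r^0_n(k), s^0_n(k)$ be the coefficients of $\Psi^0_n(k)$ in the basis $P,Q,R,S$ (see context), and for $u\in\{p,q,r,s\}$ let $$\bar u^{0}(z,t)=\sum_{k=0}^{\infty}\sum_{n=1}^{\infty}u^0_{2n}(2k)\,z^{2n}t^{2k}.$$ Put $A=\sqrt{1+z^4}$ and $B=\sqrt{1+z^4t^4}$ (the power series with constant term $1$). Then, as identities in the field of fractions of the ring of formal power series in $z,t$, \begin{align*} \bar{p}^{0} (z, t) &= \frac{z^2 t^2 \left\{ 2(1-t^2) z^2 + (1 - z^2 t^2) A +(1-z^2) B \right\}}{\sqrt{2}(1-z^2)(1-z^2t^2)\left\{ -1 + (1+A) t^2 + B \right\}},\\ \bar{r}^{0} (z, t) &= \frac{- z^4 t^2 + ( 1 + A ) (1 - B ) + z^2 \left\{ 1 + (1+A) t^2 - B \right\}}{2 \sqrt{2}(1-z^2)(1-z^2t^2)},\\ \bar{q}^{0} (z, t) &= \frac{z^2 t^2 \left[ -z^4 + z^6 t^2 + (1 + A ) \left\{ -1 + (2-t^2)z^2 - (1 - z^2) B \right\} \right]}{\sqrt{2}(1-z^2)(1-z^2t^2)(1 + A ) \left\{1 - (1 - A) t^2 + B \right\}},\\ \bar{s}^{0} (z, t) &= \frac{z^4 t^2 \left\{ (1 - z^4 t^4) A + (1-z^2)(1+z^2t^2) B + (1 - z^2 t^2) A B + (1-z^2) B^2 \right\}}{\sqrt{2}(1-z^2)(1-z^2t^2)(1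 + A)(-1+z^2t^2 + B) \left\{ 1 - (1 - A)t^2 + B \right\}}. \end{align*}
   Context: Hadamard walk: put $$P=\tfrac1{\sqrt2}\begin{bmatrix}1&1\\0&0\end{bmatrix},\quad Q=\tfrac1{\sqrt2}\begin{bmatrix}0&0\\1&-1\end{bmatrix},\quad R=\tfrac1{\sqrt2}\begin{bmatrix}1&-1\\0&0\end{bmatrix},\quad S=\tfrac1{\sqrt2}\begin{bmatrix}0&0\\1&1\end{bmatrix}.$$ $P+Q$ is the Hadamard matrix. $P$ represents a step to the left and $Q$ a step to the right. The matrices $P,Q,R,S$ form an orthonormal basis of the $2\times2$ complex matrices for $\langle A|B\rangle=\mathrm{tr}(A^*B)$. Paths: a nearest-neighbour path $(x_0,x_1,\dots,x_n)$ in $\mathbb{Z}$ (so $|x_i-x_{i-1}|=1$) has weight the matrix product $M_nM_{n-1}\cdots M_1$, where $M_i=P$ if $x_i=x_{i-1}-1$ and $M_i=Q$ if $x_i=x_{i-1}+1$ (the first step is the rightmost factor). The $i$-th time interval is spent to the right of the origin (on the positive side) if the edge $\{x_{i-1},x_i\}$ lies in $\{0,1,2,\dots\}$, i.e. $\max(x_{i-1},x_i)\ge1$. For $x\in\mathbb{Z}$, $n\ge1$, $k\ge0$, $\Psi^x_n(k)$ is the sum of the weights of all $n$-step paths starting at $x_0=x$ that spend exactly $k$ of the $n$ time intervals to the right of the origin (the zero matrix if there are none). E.g. $\Psi^0_2(0)=P^2+QP$, $\Psi^0_2(1)=O$, $\Psi^0_2(2)=Q^2+PQ$. The numbers $p^x_n(k),q^x_n(k),r^x_n(k),s^x_n(k)$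 are defined by $\Psi^x_n(k)=p^x_n(k)P+q^x_n(k)Q+r^x_n(k)R+s^x_n(k)S$. *)

(* Defs.v *)
From HB Require Import structures.
From mathcomp Require Import all_boot all_order all_algebra.
From mathcomp Require Import boolp reals complex ring.
Set Implicit Arguments.
Unset Strict Implicit.
Unset Printing Implicit Defensive.
Import Order.TTheory GRing.Theory Num.Theory.
Local Open Scope ring_scope.

(** * Formal power series in one variable *)

(* A record rather than an alias of [nat -> K], so that the Cauchy product does
   not clash with pointwise operations on functions. *)
Record fps (K : Type) : Type := Fps { fcoef : nat -> K }.

Lemma fpsP (K : Type) (f g : fps K) : fcoef f =1 fcoef g -> f = g.
Proof. by case: f g => [f] [g] /= /funext ->. Qed.

HB.instance Definition _ (K : Type) := gen_eqMixin (fps K).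
HB.instance Definition _ (K : Type) := gen_choiceMixin (fps K).

Section FpsZmodule.
Variable K : zmodType.
Implicit Types f g : fps K.

Definition fps_zero : fps K := Fps (fun=> 0).
Definition fps_opp f := Fps (fun n => - fcoef f n).
Definition fps_add f g := Fps (fun n => fcoef f n + fcoef g n).

Fact fps_addA : associative fps_add.
Proof. by move=> f g h; apply: fpsP => n /=; rewrite addrA. Qed.
Fact fps_addC : commutative fps_add.
Proof. by move=> f g; apply: fpsP => n /=; rewrite addrC. Qed.
Fact fps_add0 : left_id fps_zero fps_add.
Proof. by move=> f; apply: fpsP => n /=; rewrite add0r. Qed.
Fact fps_addN : left_inverse fps_zero fps_opp fps_add.
Proof. by move=> f; apply: fpsP => n /=; rewrite addNr. Qed.

HB.instance Definition _ :=
  GRing.isZmodule.Build (fps K) fps_addA fps_addC fps_add0 fps_addN.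

Lemma fcoef0 n : fcoef (0 : fps K) n = 0. Proof. by []. Qed.
Lemma fcoefD f g n : fcoef (f + g) n = fcoef f n + fcoef g n.
Proof. by []. Qed.
Lemma fcoefN f n : fcoef (- f) n = - fcoef f n. Proof. by []. Qed.
Lemma fcoefB f g n : fcoef (f - g) n = fcoef f n - fcoef g n.
Proof. by []. Qed.
End FpsZmodule.

Section FpsRing.
Variable K : comNzRingType.
Implicit Types f g h : fps K.

Definition fpsC (c : K) : fps K := Fps (fun n => if n == 0%N then c else 0).
Definition fpsX : fps K := Fps (fun n => (n == 1%N)%:R).
Definition fps_mul f g : fps K :=
  Fps (fun n => \sum_(i < n.+1) fcoef f i * fcoef g (n - i)%N).

Definition fps_trunc (N : nat) f : {poly K} := \poly_(i < N) fcoef f i.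

Lemma coef_fps_trunc N f n : (n < N)%N -> (fps_trunc N f)`_n = fcoef f n.
Proof. by move=> ltnN; rewrite coef_poly ltnN. Qed.

Lemma fcoef_mul_trunc N f g n : (n < N)%N ->
  fcoef (fps_mul f g) n = (fps_trunc N f * fps_trunc N g)`_n.
Proof.
move=> ltnN; rewrite coefM; apply: eq_bigr => -[i /= ltin] _.
by rewrite !coef_fps_trunc // (leq_ltn_trans _ ltnN) // ?leq_subr.
Qed.

Fact fps_mulC : commutative fps_mul.
Proof.
by move=> f g; apply: fpsP => n; rewrite !(fcoef_mul_trunc (N := n.+1)) // mulrC.
Qed.

Fact fps_mulA : associative fps_mul.
Proof.
move=> f g h; apply: fpsP => n.
transitivity (fps_trunc n.+1 f * fps_trunc n.+1 g * fps_trunc n.+1 h)`_n.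
  rewrite -mulrA coefM; apply: eq_bigr => -[i /= ltin] _.
  rewrite coef_fps_trunc //; congr (_ * _).
  by apply: (fcoef_mul_trunc (N := n.+1)); rewrite ltnS leq_subr.
rewrite coefM; apply: eq_bigr => -[i /= ltin] _.
rewrite coef_fps_trunc ?ltnS ?leq_subr //; congr (_ * _).
by rewrite -(fcoef_mul_trunc (N := n.+1)).
Qed.

Fact fps_mul1 : left_id (fpsC 1) fps_mul.
Proof.
move=> f; apply: fpsP => n /=; rewrite big_ord_recl /= mul1r subn0.
by rewrite big1 ?addr0 // => i _; rewrite mul0r.
Qed.

Fact fps_mulDl : left_distributive fps_mul +%R.
Proof.
move=> f g h; apply: fpsP => n; rewrite fcoefD /= -big_split /=.
by apply: eq_bigr => i _; rewrite mulrDl.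
Qed.

Fact fps_oner_neq0 : fpsC 1 != 0.
Proof.
by apply/eqP => /(congr1 (fun f => fcoef f 0)) /eqP /=; rewrite oner_eq0.
Qed.

HB.instance Definition _ := GRing.Zmodule_isComNzRing.Build (fps K)
  fps_mulA fps_mulC fps_mul1 fps_mulDl fps_oner_neq0.

Lemma fcoefM f g n :
  fcoef (f * g) n = \sum_(i < n.+1) fcoef f i * fcoef g (n - i)%N.
Proof. by []. Qed.

Lemma fcoef1 n : fcoef (1 : fps K) n = (n == 0%N)%:R.
Proof. by rewrite /=; case: eqP. Qed.

(* The inverse is chosen classically. *)
Definition fps_unit : {pred fps K} := fun f => `[< exists g, g * f = 1 >].
Definition fps_inv f : fps K :=
  if pselect (exists g, g * f = 1) is left ex then projT1 (cid ex) else f.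

Fact fps_mulV : {in fps_unit, left_inverse 1 fps_inv *%R}.
Proof.
move=> f /asboolP exf; rewrite /fps_inv; case: pselect => // ex.
by case: cid.
Qed.

Fact fps_unitP f g : g * f = 1 -> fps_unit f.
Proof. by move=> gf; apply/asboolP; exists g. Qed.

Fact fps_inv_out : {in [predC fps_unit], fps_inv =1 id}.
Proof.
move=> f /negP nf; rewrite /fps_inv; case: pselect => // ex.
by case: nf; apply/asboolP.
Qed.

HB.instance Definition _ := GRing.ComNzRing_hasMulInverse.Build (fps K)
  fps_mulV fps_unitP fps_inv_out.
End FpsRing.

Section FpsIntegral.
Variable K : idomainType.
Implicit Types f g : fps K.

Lemma fps_neq0_order f : f <> 0 ->
  exists2 m, fcoef f m != 0 & forall i, (i < m)%N -> fcoef f i = 0.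
Proof.
move=> f0; have ex : exists n, fcoef f n != 0.
  apply/not_existsP => fn; apply: f0; apply: fpsP => n.
  by apply/eqP/negPn/negP/fn.
exists (ex_minn ex); case: ex_minnP => // m _ min_m i ltim.
by apply/eqP; apply: contraTT ltim => /min_m; rewrite -leqNgt.
Qed.

Fact fps_integral f g : f * g = 0 -> (f == 0) || (g == 0).
Proof.
move=> fg0; case: eqP => //= /fps_neq0_order[m fm minf].
case: eqP => // /fps_neq0_order[n gn ming].
have := congr1 (fun h => fcoef h (m + n)) fg0; rewrite fcoef0 fcoefM.
have ltm : (m < (m + n).+1)%N by rewrite ltnS leq_addr.
rewrite (bigD1 (Ordinal ltm)) //= addKn big1 ?addr0 => [/eqP|i neqim].
  by rewrite mulf_eq0 (negPf fm) (negPf gn).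
have [/minf -> | leim] := ltnP i m; first by rewrite mul0r.
rewrite [X in _ * X]ming ?mulr0 // ltn_subLR; last by rewrite -ltnS.
by rewrite ltn_add2r ltn_neqAle leim andbT eq_sym.
Qed.

HB.instance Definition _ :=
  GRing.ComUnitRing_isIntegral.Build (fps K) fps_integral.
End FpsIntegral.

Lemma fps_sqrt_exists (K : comNzRingType) (h : K) (f : fps K) :
  h *+ 2 = 1 -> fcoef f 0 = 1 ->
  exists2 g : fps K, g ^+ 2 = f & fcoef g 0 = 1.
Proof.
move=> h2 f0.
pose next (s : seq K) : K :=
  h * (fcoef f (size s) - \sum_(1 <= i < size s) s`_i * s`_(size s - i)).
pose fix S n := if n is m.+1 then rcons (S m) (next (S m)) else [:: 1].
have sizeS n : size (S n) = n.+1 by elim: n => //= n IH; rewrite size_rcons IH.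
have nthS n k : (k <= n)%N -> (S n)`_k = (S k)`_k.
  elim: n => [|n IH]; first by rewrite leqn0 => /eqP ->.
  rewrite leq_eqVlt => /orP[/eqP -> //|]; rewrite ltnS => lekn.
  by rewrite [S n.+1]/= nth_rcons sizeS ltnS lekn IH.
exists (Fps (fun n => (S n)`_n)) => //; apply: fpsP => -[|n].
  by rewrite expr2 fcoefM big_ord_recl big_ord0 /= mulr1 addr0 f0.
rewrite expr2 fcoefM big_ord_recl big_ord_recr /= !subnn.
rewrite subn0 add0n /bump leq0n add1n /= mul1r mulr1.
have -> : (rcons (S n) (next (S n)))`_n.+1 = next (S n).
  by rewrite nth_rcons sizeS ltnn eqxx.
rewrite addrCA -mulr2n.
rewrite [in X in X *+ 2]/next sizeS -mulrnAl h2 mul1r big_add1 /= big_mkord.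
set s1 := \sum_(i < n) _; set s2 := \sum_(i < n) _.
suff -> : s1 = s2 by rewrite addrC subrK.
apply: eq_bigr => -[i /= ltin] _; rewrite add0n add1n !subSS.
have -> : (rcons (S i) (next (S i)))`_i.+1 = (S n)`_i.+1.
  by rewrite (nthS n i.+1).
by rewrite (nthS n (n - i)%N) // leq_subr.
Qed.

(** * Formal power series in [z] and [t]

   [fps2 C] is [C[[t]][[z]]]: the outer variable is [z], the inner one [t], and
   [fcoef (fcoef f i) j] is the coefficient of [z ^ i * t ^ j] in [f]. *)

Notation fps2 C := (fps (fps C)).

Section Fps2.
Variable C : fieldType.

Definition fps2C (c : C) : fps2 C := fpsC (fpsC c).
Definition fps2z : fps2 C := fpsX (fps C).
Definition fps2t : fps2 C := fpsC (fpsX C).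

Definition fps2_coef (f : fps2 C) (i j : nat) : C := fcoef (fcoef f i) j.

(* The series \sum_(k >= 0) \sum_(n >= 1) u (2n) (2k) z^(2n) t^(2k). *)
Definition even_gf (u : nat -> nat -> C) : fps2 C :=
  Fps (fun m => Fps (fun j =>
    if [&& (0 < m)%N, ~~ odd m & ~~ odd j] then u m j else 0)).

(* The embedding of [C[[z,t]]] in its field of fractions. *)
Definition ffrac (f : fps2 C) : {fraction fps2 C} := FracField.tofrac f.
End Fps2.

Lemma fps2_sqrt (C : numFieldType) (f : fps2 C) : fcoef f 0 = 1 ->
  exists! g : fps2 C, g ^+ 2 = f /\ fps2_coef g 0 0 = 1.
Proof.
move=> f0; have hE : fpsC (2^-1 : C) *+ 2 = 1.
  apply: fpsP => n; rewrite mulr2n fcoefD fcoef1 /=.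
  by case: n => [|n]; rewrite ?addr0 // -mulr2n -[_ *+ 2]mulr_natr mulVf ?pnatr_eq0.
have [g gf g0] := fps_sqrt_exists hE f0.
exists g; split; first by rewrite /fps2_coef g0.
move=> g' [g'f g'0]; apply/eqP; rewrite eq_sym.
have /eqP := etrans g'f (esym gf); rewrite eqf_sqr => /orP[//|/eqP g'E].
move: g'0; rewrite g'E /fps2_coef !fcoefN g0 fcoef1 /= => /eqP.
by rewrite eq_sym -subr_eq0 opprK -mulr2n pnatr_eq0.
Qed.

Lemma fps2_sqrt_z4 (C : numFieldType) : exists! g : fps2 C,
  g ^+ 2 = 1 + fps2z C ^+ 4 /\ fps2_coef g 0 0 = 1.
Proof.
apply: fps2_sqrt; rewrite exprS fcoefD fcoef1 fcoefM big_ord_recl big_ord0 /=.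
by rewrite mul0r !addr0.
Qed.

Lemma fps2_sqrt_z4t4 (C : numFieldType) : exists! g : fps2 C,
  g ^+ 2 = 1 + fps2z C ^+ 4 * fps2t C ^+ 4 /\ fps2_coef g 0 0 = 1.
Proof.
apply: fps2_sqrt; rewrite exprS -mulrA fcoefD fcoef1 fcoefM.
by rewrite big_ord_recl big_ord0 /= mul0r !addr0.
Qed.

(** * The Hadamard walk *)

Section HadamardWalk.
Variable C : numClosedFieldType.

Definition mx22 (a b c d : C) : 'M[C]_2 :=
  \matrix_(i, j) (if i == 0 then if j == 0 then a else b
                  else if j == 0 then c else d).

Definition Pmx : 'M[C]_2 := (sqrtC 2)^-1 *: mx22 1 1 0 0.
Definition Qmx : 'M[C]_2 := (sqrtC 2)^-1 *: mx22 0 0 1 (-1).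
Definition Rmx : 'M[C]_2 := (sqrtC 2)^-1 *: mx22 1 (-1) 0 0.
Definition Smx : 'M[C]_2 := (sqrtC 2)^-1 *: mx22 0 0 1 1.

(* A path (x_0, x_1, ..., x_n) is given by its starting point [x = x_0] and the
   sequence [:: x_1; ...; x_n]. *)
Fixpoint nnpaths (n : nat) (x : int) : seq (seq int) :=
  if n is m.+1 then [seq x - 1 :: s | s <- nnpaths m (x - 1)]
                    ++ [seq x + 1 :: s | s <- nnpaths m (x + 1)]
  else [:: [::]].

Fixpoint weight (x : int) (s : seq int) : 'M[C]_2 :=
  if s is y :: s' then weight y s' *m (if y == x - 1 then Pmx else Qmx)
  else 1%:M.

Fixpoint time_right (x : int) (s : seq int) : nat :=
  if s is y :: s' then ((1 <= Num.max x y)%R + time_right y s')%N else 0%N.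

Definition Psi (x : int) (n k : nat) : 'M[C]_2 :=
  \sum_(s <- nnpaths n x | time_right x s == k) weight x s.

Lemma mem_nnpaths n x s :
  (s \in nnpaths n x) =
  (size s == n) && path (fun a b : int => `|b - a| == 1) x s.
Proof.
elim: n x s => [|n IH] x [|y s] //=.
  by rewrite mem_cat; apply/negbTE/norP; split; apply/negP => /mapP[].
have memc (a : int) : (y :: s \in [seq a :: s' | s' <- nnpaths n a])
    = (y == a) && (s \in nnpaths n a).
  apply/mapP/andP => [[s' ? [-> ->]] //|[/eqP -> ?]].
  by exists s.
rewrite mem_cat !memc eqSS andbCA.
have -> : (`|y - x| == 1) = (y == x - 1) || (y == x + 1).
  rewrite eqr_norml ler01 andbT orbC !subr_eq.
  by rewrite ![_ + x]addrC.
case: eqP => [->|_]; case: eqP => [->|_]; rewrite ?IH //= ?orbb ?orbF //.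
Qed.

Lemma nnpaths_uniq n x : uniq (nnpaths n x).
Proof.
elim: n x => //= n IH x; rewrite cat_uniq !map_inj_uniq ?IH //=; last first.
- by move=> ? ? [].
- by move=> ? ? [].
rewrite andbT; apply/hasPn => _ /mapP[s _ ->]; apply/negP => /mapP[s' _ []].
by move=> /addrI.
Qed.

Lemma PQRS_basis (M : 'M[C]_2) : exists p q r s : C,
  M = p *: Pmx + q *: Qmx + r *: Rmx + s *: Smx /\
  forall p' q' r' s' : C,
    M = p' *: Pmx + q' *: Qmx + r' *: Rmx + s' *: Smx ->
    [/\ p' = p, q' = q, r' = r & s' = s].
Proof.
pose w : C := sqrtC 2; have w0 : w != 0 by rewrite sqrtC_eq0 pnatr_eq0.
exists (w / 2 * (M 0 0 + M 0 1)), (w / 2 * (M 1 0 - M 1 1)),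
  (w / 2 * (M 0 0 - M 0 1)), (w / 2 * (M 1 0 + M 1 1)); split.
  apply/matrixP => i j; rewrite !mxE -/w.
  by case: i => [[|[|//]] Hi]; case: j => [[|[|//]] Hj] /=;
    [set a := M 0 0 | set a := M 0 1 | set a := M 1 0 | set a := M 1 1];
    (rewrite (_ : M _ _ = a); last by congr (M _ _); exact: val_inj);
    field; rewrite w0.
move=> p' q' r' s' ->; rewrite !mxE /= -/w.
by split; field; rewrite w0.
Qed.
End HadamardWalk.

(* Main.v *)
From HB Require Import structures.
Require Import Defs.
From mathcomp Require Import all_boot all_order all_algebra.
From mathcomp Require Import reals complex ring zify.
Set Implicit Arguments.
Unset Strict Implicit.
Unset Printing Implicit Defensive.
Import Order.TTheory GRing.Theory Num.Theory.
Local Open Scope ring_scope.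

(** Let [(a x, b x)] be a row of the generating matrix of the paths starting at
    [x] and ending at an even site. Decomposing by the first step gives a linear
    system relating [x] to [x - 1] and [x + 1], homogeneous up to the terms coming
    from empty paths, with constant coefficients on each side of the origin. On a
    half-line, a power series solution must lie in the decaying eigendirection,
    which is one linear relation between [a 0] and [b 1], respectively between
    [b 0] and [a (-1)]; the square roots [B] and [A] come from the two
    characteristic equations. Substituting these relations in the equations at the
    origin leaves a 2x2 linear system for [a 0] and [b 0]. *)

(** * Coefficients of products of power series *)

Section FpsCoef.
Variable K : comNzRingType.
Implicit Types f g : fps K.

Lemma fcoefCM c f n : fcoef (fpsC c * f) n = c * fcoef f n.
Proof.
rewrite fcoefM big_ord_recl subn0 big1 ?addr0 // => i _.
by rewrite /= mul0r.
Qed.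

Lemma fcoefXM f n : fcoef (fpsX K * f) n = if n is m.+1 then fcoef f m else 0.
Proof.
rewrite fcoefM; case: n => [|n]; first by rewrite big_ord1 /= mul0r.
rewrite big_ord_recl big_ord_recl /= mul0r add0r mul1r subSS subn0.
by rewrite big1 ?addr0 // => i _; rewrite /= mul0r.
Qed.

Lemma fcoef0M f g : fcoef (f * g) 0 = fcoef f 0 * fcoef g 0.
Proof. by rewrite fcoefM big_ord1. Qed.

Lemma fpsC_is_zmod_morphism : zmod_morphism (@fpsC K).
Proof.
by move=> x y; apply: fpsP => -[|n]; rewrite fcoefB //= subr0.
Qed.

Lemma fpsC_is_monoid_morphism : monoid_morphism (@fpsC K).
Proof.
split=> // x y; apply: fpsP => n; rewrite fcoefCM.
by case: n => //= n; rewrite mulr0.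
Qed.

Definition fps_vanish N f := forall i, (i < N)%N -> fcoef f i = 0.

Lemma fps_vanishM g f N : fcoef g 0 = 0 -> fps_vanish N f ->
  fps_vanish N.+1 (g * f).
Proof.
move=> g0 f0 i ltiN; rewrite fcoefM big1 // => -[[|j] /= ltj] _.
  by rewrite g0 mul0r.
rewrite f0 ?mulr0 //; rewrite ltnS in ltj.
by rewrite -ltnS (leq_trans _ ltiN) // !ltnS -subSn // subSS leq_subr.
Qed.
End FpsCoef.

HB.instance Definition _ (K : comNzRingType) :=
  GRing.isZmodMorphism.Build K (fps K) (@fpsC K) (@fpsC_is_zmod_morphism K).
HB.instance Definition _ (K : comNzRingType) :=
  GRing.isMonoidMorphism.Build K (fps K) (@fpsC K) (@fpsC_is_monoid_morphism K).

(** * Power series solutions on a half-line *)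

Section FpsIdomain.
Variable K : idomainType.

(** Integrality cancels the nonzero constant coefficient of [g], starting from the lowest
    coefficient of [g * f] and going up. *)
Lemma fps_vanish_unitM (g f : fps K) N : fcoef g 0 != 0 ->
  fps_vanish N (g * f) -> fps_vanish N f.
Proof.
move=> g0 gf i; elim/ltn_ind: i => i IH ltiN.
have := gf i ltiN; rewrite fcoefM big_ord_recl subn0 big1 ?addr0 => [/eqP|j _].
  by rewrite mulf_eq0 (negPf g0) => /eqP.
have lt_i : (i - lift ord0 j < i)%N.
  by rewrite ltn_subrL (leq_ltn_trans _ (ltn_ord j)).
by rewrite IH ?mulr0 // (ltn_trans lt_i).
Qed.

(* After subtracting a particular solution, [d m] below measures the component
   of the homogeneous solution that would grow with [m]; the recurrence for [d]
   makes every [d m] divisible by all powers of the variable, hence zero. *)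
Lemma half_line (w S e1 e2 : fps K) (a b : nat -> fps K) :
  (2 : K) != 0 -> fcoef w 0 = 0 -> fcoef S 0 = 1 -> S ^+ 2 = 1 + 4 * w ^+ 4 ->
  (forall m, a m.+1 = (if odd m then e1 else 0) + w * (a m + b m.+2)) ->
  (forall m, b m.+1 = (if odd m then e2 else 0) + w * (a m - b m.+2)) ->
  2 * w * ((1 - 2 * w ^+ 2) * b 1%N - w * (e1 - e2))
  = (1 + 2 * w ^+ 2 - S) * ((1 - 2 * w ^+ 2) * a 0%N - e1).
Proof.
move=> two0 w0 S0 hS ha hb.
(* The subtracted terms are [1 - 2 * w ^+ 2] times a particular solution of period two, which clears
   its denominator. *)
pose a' m := (1 - 2 * w ^+ 2) * a m - (if odd m then w * (e1 + e2) else e1).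
pose b' m := (1 - 2 * w ^+ 2) * b m - (if odd m then w * (e1 - e2) else e2).
have ha' m : a' m.+1 = w * (a' m + b' m.+2).
  by rewrite /a' /b' ha /=; case: (odd m) => /=; ring.
have hb' m : b' m.+1 = w * (a' m - b' m.+2).
  by rewrite /a' /b' hb /=; case: (odd m) => /=; ring.
pose d m := 2 * w * b' m.+1 - (1 + 2 * w ^+ 2 - S) * a' m.
(* After [ha'] and [hb'], the terms in [b' m.+2] agree identically and those in [a' m] agree by the
   quadratic equation [hS]. *)
have hd m : (1 - 2 * w ^+ 2 + S) * d m = - 2 * w * d m.+1.
  by rewrite /d ha' hb'; ring: hS.
have S1 : fcoef (1 - 2 * w ^+ 2 + S) 0 != 0.
  by rewrite fcoefD fcoefB S0 !fcoef0M w0 mul0r mulr0 subr0.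
have dV N : forall m, fps_vanish N (d m).
  elim: N => [//|N IH] m; apply: (fps_vanish_unitM S1); rewrite hd.
  by apply: fps_vanishM; rewrite ?fcoef0M ?w0 ?mulr0.
have : d 0%N = 0 by apply: fpsP => i; rewrite (dV i.+1).
by move/eqP; rewrite subr_eq0 => /eqP.
Qed.
End FpsIdomain.

(** * Linear algebra at the origin *)

Section CentreAlgebra.
Variables (F : idomainType) (z t A B : F).
Hypotheses (hA : A ^+ 2 = 1 + z ^+ 4) (hB : B ^+ 2 = 1 + z ^+ 4 * t ^+ 4).

(* The system for the two entries [a], [b] of a row at the origin, after the
   neighbouring entries at -1 and 1 have been eliminated by [half_line]. *)
Definition centre_eqs (e1 e2 a b : F) :=
  let L := (1 - z ^+ 2 * t ^+ 2) * (z ^+ 2 * (e1 + e2) - (1 + z ^+ 2 - A) * e2) in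
  let M := (1 - z ^+ 2) * (z ^+ 2 * t ^+ 2 * (e1 - e2)
                           - (1 + z ^+ 2 * t ^+ 2 - B) * e1) in
  let d := (1 - z ^+ 2) * (1 - z ^+ 2 * t ^+ 2) in
  d * ((1 - z ^+ 2 * t ^+ 2 + B) * a - (1 + z ^+ 2 - A) * b) = 2 * d * e1 + L + M
  /\ d * ((1 - z ^+ 2 + A) * b + (1 + z ^+ 2 * t ^+ 2 - B) * a)
     = 2 * d * e2 + L - M.

(** Determinant of the system [centre_eqs], once the common factor [d] of its two equations is set
    aside. *)
Let E := (1 - z ^+ 2 * t ^+ 2 + B) * (1 - z ^+ 2 + A)
         + (1 + z ^+ 2 * t ^+ 2 - B) * (1 + z ^+ 2 - A).
Hypothesis E0 : E != 0.

(** Cramer's rule without division. *)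
Lemma centre_sol e1 e2 a b : centre_eqs e1 e2 a b ->
  let L := (1 - z ^+ 2 * t ^+ 2) * (z ^+ 2 * (e1 + e2) - (1 + z ^+ 2 - A) * e2) in
  let M := (1 - z ^+ 2) * (z ^+ 2 * t ^+ 2 * (e1 - e2)
                           - (1 + z ^+ 2 * t ^+ 2 - B) * e1) in
  let d := (1 - z ^+ 2) * (1 - z ^+ 2 * t ^+ 2) in
  d * E * a = (1 - z ^+ 2 + A) * (2 * d * e1 + L + M)
              + (1 + z ^+ 2 - A) * (2 * d * e2 + L - M)
  /\ d * E * b = (1 - z ^+ 2 * t ^+ 2 + B) * (2 * d * e2 + L - M)
              - (1 + z ^+ 2 * t ^+ 2 - B) * (2 * d * e1 + L + M).
Proof. by move=> [H1 H2] L M d; split; rewrite -H1 -H2 /E /d; ring. Qed.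

(** Multiplying by the cancellable [E] lets Cramer's formulas apply; what remains is a polynomial
    identity modulo the equations for [A ^+ 2] and [B ^+ 2]. The same scheme serves [r], [q] and
    [s]. *)
Lemma p_cleared w f a b : w * f = a + b - 1 ->
  centre_eqs 1 0 a b ->
  f * (w * (1 - z ^+ 2) * (1 - z ^+ 2 * t ^+ 2)
                 * (- 1 + (1 + A) * t ^+ 2 + B))
  = z ^+ 2 * t ^+ 2 * (2 * (1 - t ^+ 2) * z ^+ 2 + (1 - z ^+ 2 * t ^+ 2) * A
                       + (1 - z ^+ 2) * B).
Proof.
move=> Hf /centre_sol[]; set d := _ * (1 - _ * _) => Ha Hb.
apply: (mulfI E0).
transitivity (E * (w * f) * d * (- 1 + (1 + A) * t ^+ 2 + B)).
  by rewrite /d; ring.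
transitivity ((d * E * a + d * E * b - d * E) * (- 1 + (1 + A) * t ^+ 2 + B)).
  by rewrite Hf; ring.
by rewrite Ha Hb /d /E; ring: hA hB.
Qed.

Lemma r_cleared w f a b : w * f = a - b - 1 ->
  centre_eqs 1 0 a b ->
  f * (2 * w * (1 - z ^+ 2) * (1 - z ^+ 2 * t ^+ 2))
  = - (z ^+ 4) * t ^+ 2 + (1 + A) * (1 - B)
    + z ^+ 2 * (1 + (1 + A) * t ^+ 2 - B).
Proof.
move=> Hf /centre_sol[]; set d := _ * (1 - _ * _) => Ha Hb.
apply: (mulfI E0).
transitivity (2 * (E * (w * f) * d)).
  by rewrite /d; ring.
transitivity (2 * (d * E * a - d * E * b - d * E)).
  by rewrite Hf; ring.
by rewrite Ha Hb /d /E; ring: hA hB.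
Qed.

(** In the second row the empty path contributes 1 to [b], which enters here with a minus sign;
    hence the correction [+ 1]. *)
Lemma q_cleared w f a b : w * f = a - b + 1 ->
  centre_eqs 0 1 a b ->
  f * (w * (1 - z ^+ 2) * (1 - z ^+ 2 * t ^+ 2) * (1 + A)
           * (1 - (1 - A) * t ^+ 2 + B))
  = z ^+ 2 * t ^+ 2
         * (- (z ^+ 4) + z ^+ 6 * t ^+ 2
            + (1 + A) * (- 1 + (2 - t ^+ 2) * z ^+ 2 - (1 - z ^+ 2) * B)).
Proof.
move=> Hf /centre_sol[]; set d := _ * (1 - _ * _) => Ha Hb.
apply: (mulfI E0).
transitivity (E * (w * f) * d * ((1 + A) * (1 - (1 - A) * t ^+ 2 + B))).
  by rewrite /d; ring.
transitivity ((d * E * a - d * E * b + d * E) *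
   ((1 + A) * (1 - (1 - A) * t ^+ 2 + B))).
  by rewrite Hf; ring.
by rewrite Ha Hb /d /E; ring: hA hB.
Qed.

Lemma s_cleared w f a b : w * f = a + b - 1 ->
  centre_eqs 0 1 a b ->
  f * (w * (1 - z ^+ 2) * (1 - z ^+ 2 * t ^+ 2) * (1 + A)
           * (- 1 + z ^+ 2 * t ^+ 2 + B) * (1 - (1 - A) * t ^+ 2 + B))
  = z ^+ 4 * t ^+ 2
         * ((1 - z ^+ 4 * t ^+ 4) * A
            + (1 - z ^+ 2) * (1 + z ^+ 2 * t ^+ 2) * B
            + (1 - z ^+ 2 * t ^+ 2) * A * B + (1 - z ^+ 2) * B ^+ 2).
Proof.
move=> Hf /centre_sol[]; set d := _ * (1 - _ * _) => Ha Hb.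
apply: (mulfI E0).
transitivity (E * (w * f) * d *
   ((1 + A) * (- 1 + z ^+ 2 * t ^+ 2 + B) * (1 - (1 - A) * t ^+ 2 + B))).
  by rewrite /d; ring.
transitivity ((d * E * a + d * E * b - d * E) *
   ((1 + A) * (- 1 + z ^+ 2 * t ^+ 2 + B) * (1 - (1 - A) * t ^+ 2 + B))).
  by rewrite Hf; ring.
by rewrite Ha Hb /d /E; ring: hA hB.
Qed.
End CentreAlgebra.

(** * First-step recurrence for the generating series *)

Section WalkSeries.
Variable C : numClosedFieldType.
Implicit Types (x : int) (n k : nat) (i j : 'I_2).

Definition shift (T : nmodType) (c : bool) (f : nat -> T) k : T :=
  if c then if k is k'.+1 then f k' else 0 else f k.

Lemma Psi0 x k : Psi C x 0 k = if k == 0%N then 1%:M else 0.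
Proof. by rewrite /Psi /= big_cons big_nil eq_sym; case: eqP; rewrite ?addr0. Qed.

(** The first step is the rightmost factor of the weight, so it acts on columns and the rows of
    [Psi] never mix. The edge below [x] is on the right iff [1 <= x], the edge above iff
    [0 <= x]. *)
Lemma PsiS x n k : Psi C x n.+1 k =
  shift (1 <= x) (Psi C (x - 1) n) k *m Pmx C
  + shift (0 <= x) (Psi C (x + 1) n) k *m Qmx C.
Proof.
have sumE (y : int) (c : bool) (M : 'M[C]_2) :
    \sum_(s <- nnpaths n y | (c + time_right y s)%N == k) weight C y s *m M
    = shift c (Psi C y n) k *m M.
  case: c k => [[|k]|k]; rewrite /shift /Psi ?mulmx_suml //.
  by rewrite mul0mx big_pred0.
rewrite {1}/Psi /= big_cat /= !big_map /= eqxx -!sumE.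
have -> : (1 <= Num.max x (x - 1)) = (1 <= x) by lia.
have -> : (1 <= Num.max x (x + 1)) = (0 <= x) by lia.
by have -> : (x + 1 == x - 1) = false by lia.
Qed.

(* Every path from [x] to an even site has these parities for its number [n] of
   steps and its time [k] on the right; so at [x = 0] only the even coefficients
   are kept, and the first-step recurrence still closes. *)
Definition parity_ok x n k :=
  (odd n == odd `|x|%N) && (odd k == (0 < x) && odd `|x|%N).

Definition walk_gf i j x : fps2 C :=
  Fps (fun n => Fps (fun k => if parity_ok x n k then Psi C x n k i j else 0)).

Definition tshift (c : bool) (f : fps2 C) := if c then fps2t C * f else f.

Lemma fps2_coef_tshift c f n k :
  fps2_coef (tshift c f) n k = shift c (fps2_coef f n) k.
Proof.
rewrite /fps2_coef /tshift; case: c => //.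
by rewrite fcoefCM fcoefXM; case: k.
Qed.

Let h : C := (sqrtC 2)^-1.

(** Here [y] is the start and [x] the site after the first step: by [hc] the parity filter at [x]
    becomes the one at [y] once the step is counted. *)
Lemma shift_gf (c : bool) i j x n k y :
  (forall k, parity_ok y n.+1 (c + k) = parity_ok x n k) ->
  shift c (fps2_coef (walk_gf i j x) n) k =
  if parity_ok y n.+1 k then shift c (Psi C x n) k i j else 0.
Proof.
move=> hc; rewrite /fps2_coef /shift /=; case: c k hc => [[|k]|k] hc.
- by rewrite mxE if_same.
- by rewrite -hc.
- by rewrite -hc.
Qed.

(** A step on the positive side flips both the time count and its required parity; elsewhere a step
    changes neither. *)
Lemma parity_ok_left x n k :
  parity_ok x n.+1 ((1 <= x)%R + k) = parity_ok (x - 1) n k.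
Proof.
rewrite /parity_ok oddD; case: x => [[|m]|m].
- by rewrite /=; case: (odd n); case: (odd k).
- have -> : m.+1%:Z - 1 = m by lia.
  rewrite /=; case: m => [|m] /=; case: (odd n); case: (odd k) => //=;
    by case: (odd m).
have -> : Negz m - 1 = Negz m.+1 by lia.
by rewrite /=; case: (odd n); case: (odd k); case: (odd m).
Qed.

Lemma parity_ok_right x n k :
  parity_ok x n.+1 ((0 <= x)%R + k) = parity_ok (x + 1) n k.
Proof.
rewrite /parity_ok oddD; case: x => [m|[|m]].
- have -> : m%:Z + 1 = m.+1 by lia.
  rewrite /=; case: m => [|m] /=; case: (odd n); case: (odd k) => //=;
    by case: (odd m).
- by rewrite /=; case: (odd n); case: (odd k).
have -> : Negz m.+1 + 1 = Negz m by lia.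
by rewrite /=; case: (odd n); case: (odd k); case: (odd m).
Qed.

(** Right multiplication by [Pmx] reads only column 0, and by [Qmx] only column 1, with sign
    [(-1) ^+ j]. The constant term is the empty path, kept at even sites. *)
Lemma walk_gf_eq i x (j : 'I_2) : walk_gf i j x =
  ((i == j) && ~~ odd `|x|%N)%:R
  + fps2z C * (fps2C h * (tshift (1 <= x) (walk_gf i 0 (x - 1))
       + (-1) ^+ j * tshift (0 <= x) (walk_gf i 1 (x + 1)))).
Proof.
have fcn (b : bool) : b%:R = fps2C (b%:R : C) by rewrite /fps2C !rmorph_nat.
apply: fpsP => n; apply: fpsP => k.
rewrite fcn fcoefD /fps2C /fps2z fcoefXM; case: n => [|n].
  rewrite addr0 /= /parity_ok /= Psi0.
  case: k => [|k] /=.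
    by rewrite mxE; case: (odd _); rewrite /= ?andbF ?andbT.
  by rewrite mxE if_same.
rewrite add0r fcoefCM fcoefCM fcoefD.
have -> : (-1) ^+ j = fpsC (fpsC ((-1) ^+ j)) :> fps2 C by rewrite !rmorph_sign.
rewrite !fcoefCM.
rewrite -![fcoef (fcoef _ _) _]/(fps2_coef _ _ _) !fps2_coef_tshift.
rewrite (shift_gf _ _ _ (fun k => parity_ok_left x n k)).
rewrite (shift_gf _ _ _ (fun k => parity_ok_right x n k)).
rewrite /fps2_coef /=; case: ifP => _; last by rewrite mulr0 addr0 mulr0.
rewrite PsiS !mxE !big_ord_recl !big_ord0 !mxE -/h.
have -> : lift ord0 ord0 = 1 :> 'I_2 by apply: val_inj.
rewrite -[ord0]/(0 : 'I_2) eqxx.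
by case: j => [[|[|//]] ?] /=; ring.
Qed.
End WalkSeries.

(** * The walk satisfies the equations at the origin *)

Section Centre.
Variables (C : numClosedFieldType) (sA sB : fps2 C).
Let z := fps2z C.
Let t := fps2t C.
Hypotheses (hA : sA ^+ 2 = 1 + z ^+ 4) (hA0 : fps2_coef sA 0 0 = 1).
Hypotheses (hB : sB ^+ 2 = 1 + z ^+ 4 * t ^+ 4) (hB0 : fps2_coef sB 0 0 = 1).

Lemma fps2z0 : fcoef z 0 = 0.
Proof. by apply: fpsP. Qed.

(** Only one coefficient of the root is prescribed, whereas [half_line] needs its whole constant
    term in [z]; integrality leaves 1 and -1. *)
Lemma fcoef0_sqrt (S : fps2 C) : fcoef S 0 ^+ 2 = 1 -> fps2_coef S 0 0 = 1 ->
  fcoef S 0 = 1.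
Proof.
move=> /eqP; rewrite sqrf_eq1 => /orP[/eqP //|/eqP].
rewrite /fps2_coef => ->; rewrite fcoefN fcoef1 => /eqP.
by rewrite eq_sym -subr_eq0 opprK -mulr2n pnatr_eq0.
Qed.

Lemma fcoef0_sA : fcoef sA 0 = 1.
Proof.
apply: fcoef0_sqrt hA0.
by rewrite -[1 in RHS](addr0) expr2 -fcoef0M -expr2 hA fcoefD fcoef0M fps2z0 mul0r.
Qed.

Lemma fcoef0_sB : fcoef sB 0 = 1.
Proof.
apply: fcoef0_sqrt hB0.
by rewrite -[1 in RHS](addr0) expr2 -fcoef0M -expr2 hB fcoefD !fcoef0M fps2z0 !mul0r.
Qed.

Lemma fps_two_neq0 : (2 : fps C) != 0.
Proof.
apply/eqP => /(congr1 (fun f => fcoef f 0)) /eqP.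
by rewrite mulr2n fcoefD fcoef1 -mulr2n pnatr_eq0.
Qed.

Lemma walk_gf0_eq i x : walk_gf C i 0 x = ((i == 0) && ~~ odd `|x|%N)%:R
  + z * (fps2C (sqrtC 2)^-1 * (tshift (1 <= x) (walk_gf C i 0 (x - 1))
                               + tshift (0 <= x) (walk_gf C i 1 (x + 1)))).
Proof. by rewrite {1}walk_gf_eq mul1r. Qed.

Lemma walk_gf1_eq i x : walk_gf C i 1 x = ((i == 1) && ~~ odd `|x|%N)%:R
  + z * (fps2C (sqrtC 2)^-1 * (tshift (1 <= x) (walk_gf C i 0 (x - 1))
                               - tshift (0 <= x) (walk_gf C i 1 (x + 1)))).
Proof. by rewrite {1}walk_gf_eq mulN1r. Qed.

Lemma walk_centre_eqs (i : 'I_2) :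
  centre_eqs z t sA sB (i == 0)%:R (i == 1)%:R (walk_gf C i 0 0) (walk_gf C i 1 0).
Proof.
pose H := fps2C (sqrtC 2)^-1 : fps2 C.
have hH : 2 * H ^+ 2 = 1.
  rewrite /H /fps2C -!rmorphXn exprVn sqrtCK -[2](rmorph_nat (@fpsC _)).
  by rewrite -[2](rmorph_nat (@fpsC _)) -!rmorphM mulfV ?pnatr_eq0 // !rmorph1.
pose a x := walk_gf C i 0 x; pose b x := walk_gf C i 1 x.
set e1 : fps2 C := (i == 0)%:R; set e2 : fps2 C := (i == 1)%:R.
rewrite -/(a 0) -/(b 0).
pose v := z * H; pose w := v * t.
have v2 : 2 * v ^+ 2 = z ^+ 2.
  by transitivity (z ^+ 2 * (2 * H ^+ 2)); [rewrite /v; ring | rewrite hH mulr1].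
have w2 : 2 * w ^+ 2 = z ^+ 2 * t ^+ 2.
  by rewrite -v2 /w; ring.
have v0 : fcoef v 0 = 0 by rewrite fcoef0M fps2z0 mul0r.
have w0 : fcoef w 0 = 0 by rewrite fcoef0M v0 mul0r.
have right : 2 * w * ((1 - 2 * w ^+ 2) * b 1%N - w * (e1 - e2))
  = (1 + 2 * w ^+ 2 - sB) * ((1 - 2 * w ^+ 2) * a 0%N - e1).
  apply: (half_line fps_two_neq0 w0 fcoef0_sB (a := fun m : nat => a m%:Z)
    (b := fun m : nat => b m%:Z)).
  - transitivity (1 + (z ^+ 2 * t ^+ 2) ^+ 2); first by rewrite hB; ring.
    by rewrite -w2; ring.
  - move=> m; rewrite {1}/a walk_gf0_eq -/(a _) -/(b _) -/H.
    have -> : m.+1%:Z - 1 = m by lia.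
    have -> : m.+1%:Z + 1 = m.+2 by lia.
    rewrite /= negbK /w /v /e1.
    by case: (odd m); rewrite ?andbT ?andbF /= ?mulr0n; ring.
  - move=> m; rewrite {1}/b walk_gf1_eq -/(a _) -/(b _) -/H.
    have -> : m.+1%:Z - 1 = m by lia.
    have -> : m.+1%:Z + 1 = m.+2 by lia.
    rewrite /= negbK /w /v /e2.
    by case: (odd m); rewrite ?andbT ?andbF /= ?mulr0n; ring.
(* Reflection in the origin exchanges the two columns; negating [a], [e1] and [v] restores the form
   of the recurrence in [half_line]. *)
have left : 2 * - v * ((1 - 2 * (- v) ^+ 2) * - a (- 1)%Z - - v * (e2 - - e1))
  = (1 + 2 * (- v) ^+ 2 - sA) * ((1 - 2 * (- v) ^+ 2) * b (- 0) - e2).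
  apply: (half_line fps_two_neq0 _ fcoef0_sA (a := fun m : nat => b (- m%:Z))
    (b := fun m : nat => - a (- m%:Z))).
  - by rewrite fcoefN v0 oppr0.
  - transitivity (1 + (z ^+ 2) ^+ 2); first by rewrite hA; ring.
    by rewrite -v2; ring.
  - move=> m; rewrite {1}/b walk_gf1_eq -/(a _) -/(b _) -/H.
    have -> : - m.+1%:Z - 1 = - m.+2%:Z by lia.
    have -> : - m.+1%:Z + 1 = - m%:Z by lia.
    have -> : (1 <= - m.+1%:Z) = false by lia.
    have -> : (0 <= - m.+1%:Z) = false by lia.
    rewrite abszN /= negbK /v /e2.
    by case: (odd m); rewrite ?andbT ?andbF /= ?mulr0n; ring.
  - move=> m; rewrite {1}/a walk_gf0_eq -/(a _) -/(b _) -/H.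
    have -> : - m.+1%:Z - 1 = - m.+2%:Z by lia.
    have -> : - m.+1%:Z + 1 = - m%:Z by lia.
    have -> : (1 <= - m.+1%:Z) = false by lia.
    have -> : (0 <= - m.+1%:Z) = false by lia.
    rewrite abszN /= negbK /v /e1.
    by case: (odd m); rewrite ?andbT ?andbF /= ?mulr0n; ring.
have Ea : a 0 = e1 + v * a (-1) + w * b 1.
  rewrite {1}/a walk_gf0_eq -/(a _) -/(b _) -/H sub0r add0r andbT -/e1.
  by rewrite /tshift /= /w /v; ring.
have Eb : b 0 = e2 + v * a (-1) - w * b 1.
  rewrite {1}/b walk_gf1_eq -/(a _) -/(b _) -/H sub0r add0r andbT -/e2.
  by rewrite /tshift /= /w /v; ring.
rewrite sqrrN oppr0 v2 in left; rewrite w2 in right.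
(* Both relations are rearranged for [w * b 1] and [v * a (-1)], the combinations occurring in [Ea]
   and [Eb]. *)
have {}right : 2 * (1 - z ^+ 2 * t ^+ 2) * (w * b 1) =
  (1 + z ^+ 2 * t ^+ 2 - sB) * ((1 - z ^+ 2 * t ^+ 2) * a 0 - e1)
  + z ^+ 2 * t ^+ 2 * (e1 - e2).
  by rewrite -right -w2; ring.
have {}left : 2 * (1 - z ^+ 2) * (v * a (-1)) =
  (1 + z ^+ 2 - sA) * ((1 - z ^+ 2) * b 0 - e2) + z ^+ 2 * (e1 + e2).
  by rewrite -left -v2; ring.
set d := (1 - z ^+ 2) * (1 - z ^+ 2 * t ^+ 2).
have Fa : d * (2 * a 0) = d * (2 * e1)
    + (1 - z ^+ 2 * t ^+ 2) * (2 * (1 - z ^+ 2) * (v * a (-1)))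
    + (1 - z ^+ 2) * (2 * (1 - z ^+ 2 * t ^+ 2) * (w * b 1)).
  by rewrite {1}Ea /d; ring.
have Fb : d * (2 * b 0) = d * (2 * e2)
    + (1 - z ^+ 2 * t ^+ 2) * (2 * (1 - z ^+ 2) * (v * a (-1)))
    - (1 - z ^+ 2) * (2 * (1 - z ^+ 2 * t ^+ 2) * (w * b 1)).
  by rewrite {1}Eb /d; ring.
rewrite left right in Fa Fb.
split; rewrite -/d.
  transitivity (d * (2 * a 0) - d * ((1 + z ^+ 2 * t ^+ 2 - sB) * a 0
     + (1 + z ^+ 2 - sA) * b 0)); first by ring.
  by rewrite Fa /d; ring.
transitivity (d * (2 * b 0) + d * ((1 + z ^+ 2 * t ^+ 2 - sB) * a 0
     - (1 + z ^+ 2 - sA) * b 0)); first by ring.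
by rewrite Fb /d; ring.
Qed.
End Centre.

Lemma fps2_coefB (C : fieldType) (f g : fps2 C) n k :
  fps2_coef (f - g) n k = fps2_coef f n k - fps2_coef g n k.
Proof. by []. Qed.

Lemma fps2_coefD (C : fieldType) (f g : fps2 C) n k :
  fps2_coef (f + g) n k = fps2_coef f n k + fps2_coef g n k.
Proof. by []. Qed.

Lemma fps2_coefCM (C : fieldType) c (f : fps2 C) n k :
  fps2_coef (fps2C c * f) n k = c * fps2_coef f n k.
Proof. by rewrite /fps2_coef /fps2C !fcoefCM. Qed.

(** At the origin the parity filter is that of [even_gf]. The series differ only in degree 0 in [z],
    where the empty path gives row [i] of the identity, subtracted here. *)
Lemma even_gf_walk (C : numClosedFieldType) (u : nat -> nat -> C)
    (i : 'I_2) (sg : bool) :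
  (forall n k, (1 <= n)%N -> u n k =
     (sqrtC 2)^-1 * (Psi C 0 n k i 0 + (-1) ^+ sg * Psi C 0 n k i 1)) ->
  fps2C (sqrtC 2) * even_gf u =
    walk_gf C i 0 0 + (-1) ^+ sg * walk_gf C i 1 0
       - ((i == 0)%:R + (-1) ^+ sg * (i == 1)%:R).
Proof.
move=> hu; apply: fpsP => n; apply: fpsP => k.
have -> : (-1) ^+ sg = fps2C ((-1) ^+ sg) :> fps2 C.
  by rewrite /fps2C !rmorph_sign.
have fcn (b : bool) : b%:R = fps2C (b%:R : C) by rewrite /fps2C !rmorph_nat.
have w0 : sqrtC 2 != 0 :> C by rewrite sqrtC_eq0 pnatr_eq0.
rewrite !fcn -[LHS]/(fps2_coef _ n k) -[RHS]/(fps2_coef _ n k).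
rewrite fps2_coefB !fps2_coefD !fps2_coefCM /fps2_coef.
case: n => [|n] /=.
  rewrite mulr0 /parity_ok /= Psi0; case: k => [|k] /=.
    by rewrite !mxE subrr.
  by rewrite !mxE !if_same !mulr0 addr0 subrr.
rewrite mulr0 addr0 subr0 /parity_ok /= !eqbF_neg.
by case: ifP => [_|_]; rewrite ?hu ?mulVKf // !mulr0 addr0.
Qed.

(** * Passage to the field of fractions *)

Section Frac.
Variable C : fieldType.
Implicit Types f g : fps2 C.

Lemma ffracM : {morph @ffrac C : f g / f * g}. Proof. exact: rmorphM. Qed.
Lemma ffracD : {morph @ffrac C : f g / f + g}. Proof. exact: rmorphD. Qed.
Lemma ffracN : {morph @ffrac C : f / - f}. Proof. exact: rmorphN. Qed.
Lemma ffracX n : {morph @ffrac C : f / f ^+ n}. Proof. exact: rmorphXn. Qed.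
Lemma ffrac1 : ffrac 1 = 1 :> {fraction fps2 C}. Proof. exact: rmorph1. Qed.

Definition ffracE := (ffracX, ffracM, ffracD, ffracN).

Lemma fps2C_neq0 (c : C) : c != 0 -> fps2C c != 0.
Proof.
move=> c0; apply/eqP => /(congr1 (fun f => fps2_coef f 0 0)) /eqP.
by rewrite /fps2_coef /= (negPf c0).
Qed.

Lemma ffrac_div f d n : d != 0 -> f * d = n -> ffrac f = ffrac n / ffrac d.
Proof.
move=> d0 <-; have d'0 : ffrac d != 0 by rewrite /ffrac tofrac_eq0.
by apply: (mulIf d'0); rewrite divfK // ffracM.
Qed.
End Frac.

(* Over an abstract [C], because tactics unfold the operations of [R[i]]. *)
Theorem even_gf_Hadamard (C : numClosedFieldType)
  (p q r s : nat -> nat -> C)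
  (hPsi : forall n k : nat, (1 <= n)%N ->
    Psi C 0 n k = p n k *: Pmx C + q n k *: Qmx C
                     + r n k *: Rmx C + s n k *: Smx C)
  (sA sB : fps2 C)
  (hA : sA ^+ 2 = 1 + fps2z C ^+ 4)
  (hA0 : fps2_coef sA 0 0 = 1)
  (hB : sB ^+ 2 = 1 + fps2z C ^+ 4 * fps2t C ^+ 4)
  (hB0 : fps2_coef sB 0 0 = 1) :
  let z := ffrac (fps2z C) in
  let t := ffrac (fps2t C) in
  let A := ffrac sA in
  let B := ffrac sB in
  let sqrt2 := ffrac (fps2C (sqrtC 2)) in
  [/\ ffrac (even_gf p) =
        (z ^+ 2 * t ^+ 2
         * (2 * (1 - t ^+ 2) * z ^+ 2 + (1 - z ^+ 2 * t ^+ 2) * A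
            + (1 - z ^+ 2) * B))
        / (sqrt2 * (1 - z ^+ 2) * (1 - z ^+ 2 * t ^+ 2)
           * (- 1 + (1 + A) * t ^+ 2 + B)),
      ffrac (even_gf r) =
        (- (z ^+ 4) * t ^+ 2 + (1 + A) * (1 - B)
         + z ^+ 2 * (1 + (1 + A) * t ^+ 2 - B))
        / (2 * sqrt2 * (1 - z ^+ 2) * (1 - z ^+ 2 * t ^+ 2)),
      ffrac (even_gf q) =
        (z ^+ 2 * t ^+ 2
         * (- (z ^+ 4) + z ^+ 6 * t ^+ 2
            + (1 + A) * (- 1 + (2 - t ^+ 2) * z ^+ 2 - (1 - z ^+ 2) * B)))
        / (sqrt2 * (1 - z ^+ 2) * (1 - z ^+ 2 * t ^+ 2) * (1 + A)
           * (1 - (1 - A) * t ^+ 2 + B))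
    & ffrac (even_gf s) =
        (z ^+ 4 * t ^+ 2
         * ((1 - z ^+ 4 * t ^+ 4) * A
            + (1 - z ^+ 2) * (1 + z ^+ 2 * t ^+ 2) * B
            + (1 - z ^+ 2 * t ^+ 2) * A * B + (1 - z ^+ 2) * B ^+ 2))
        / (sqrt2 * (1 - z ^+ 2) * (1 - z ^+ 2 * t ^+ 2) * (1 + A)
           * (- 1 + z ^+ 2 * t ^+ 2 + B) * (1 - (1 - A) * t ^+ 2 + B))].
Proof.
move=> z t A B sqrt2.
pose w := sqrtC 2 : C.
have w0 : w != 0 by rewrite sqrtC_eq0 pnatr_eq0.
have ww : w^-1 * w^-1 * 2 = 1.
  by rewrite -invfM -expr2 sqrtCK mulVf ?pnatr_eq0.
(* Row 0 involves only [p] and [r], row 1 only [s] and [q], so each coefficient is a sum or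
   difference of the two entries of a row. *)
have entry n k (i : 'I_2) (j : 'I_2) : (1 <= n)%N -> Psi C 0 n k i j =
   w^-1 * (if i == 0 then p n k + (-1) ^+ j * r n k
           else s n k + (-1) ^+ j * q n k).
  move=> n0; rewrite hPsi // !mxE -/w.
  by case: i => [[|[|//]] ?]; case: j => [[|[|//]] ?] /=; ring.
have gp : fps2C w * even_gf p = walk_gf C 0 0 0 + walk_gf C 0 1 0 - 1.
  rewrite (@even_gf_walk C p 0 false) => [|n k n0].
    by rewrite /= expr0; ring.
  transitivity (w^-1 * w^-1 * 2 * p n k); first by rewrite ww mul1r.
  by rewrite !entry //= ?expr0 ?expr1; ring.
have gr : fps2C w * even_gf r = walk_gf C 0 0 0 - walk_gf C 0 1 0 - 1.
  rewrite (@even_gf_walk C r 0 true) => [|n k n0].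
    by rewrite /= expr1; ring.
  transitivity (w^-1 * w^-1 * 2 * r n k); first by rewrite ww mul1r.
  by rewrite !entry //= ?expr0 ?expr1; ring.
have gq : fps2C w * even_gf q = walk_gf C 1 0 0 - walk_gf C 1 1 0 + 1.
  rewrite (@even_gf_walk C q 1 true) => [|n k n0].
    by rewrite /= expr1; ring.
  transitivity (w^-1 * w^-1 * 2 * q n k); first by rewrite ww mul1r.
  by rewrite !entry //= ?expr0 ?expr1; ring.
have gs : fps2C w * even_gf s = walk_gf C 1 0 0 + walk_gf C 1 1 0 - 1.
  rewrite (@even_gf_walk C s 1 false) => [|n k n0].
    by rewrite /= expr0; ring.
  transitivity (w^-1 * w^-1 * 2 * s n k); first by rewrite ww mul1r.
  by rewrite !entry //= ?expr0 ?expr1; ring.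
have hA1 := fcoef0_sA hA hA0; have hB1 := fcoef0_sB hB hB0.
have z0 : fcoef (fps2z C) 0 = 0 by exact: fps2z0.
have neq0 (f : fps2 C) : fcoef f 0 != 0 -> f != 0.
  by apply: contraNneq => ->.
have two0 := fps_two_neq0 C.
have c0 : 1 - fps2z C ^+ 2 != 0.
  by apply: neq0; rewrite fcoefB fcoef0M z0 mul0r subr0 oner_neq0.
have c'0 : 1 - fps2z C ^+ 2 * fps2t C ^+ 2 != 0.
  by apply: neq0; rewrite fcoefB !fcoef0M z0 !mul0r subr0 oner_neq0.
have A0 : 1 + sA != 0 by apply: neq0; rewrite fcoefD hA1.
have zs0 : fps2z C != 0.
  apply/eqP => /(congr1 (fun f => fcoef f 1)) /eqP.
  by rewrite fcoef0 /= oner_eq0.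
have t2 : fcoef (fps2t C) 0 != 0.
  apply/eqP => /(congr1 (fun f => fcoef f 1)) /eqP.
  by rewrite fcoef0 /= oner_eq0.
have ts0 := neq0 _ t2.
have two2 : (2 : fps2 C) != 0 by apply: neq0; rewrite mulr2n fcoefD fcoef1.
(* The constant term in [z] is [2 * t ^+ 2], nonzero though not invertible as a power series. *)
have Dp0 : - 1 + (1 + sA) * fps2t C ^+ 2 + sB != 0.
  apply: neq0; rewrite !fcoefD fcoefN !fcoef0M fcoefD hA1 hB1 fcoef1 addrAC addNr add0r.
  by rewrite mulf_neq0 ?mulf_neq0.
have Dq0 : 1 - (1 - sA) * fps2t C ^+ 2 + sB != 0.
  by apply: neq0; rewrite fcoefD fcoefB fcoef0M fcoefB hA1 hB1 subrr mul0r subr0.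
(* The constant term in [z] vanishes here, so the factor is multiplied by its conjugate. *)
have Ds0 : - 1 + fps2z C ^+ 2 * fps2t C ^+ 2 + sB != 0.
  have : (- 1 + fps2z C ^+ 2 * fps2t C ^+ 2 + sB)
         * (1 - fps2z C ^+ 2 * fps2t C ^+ 2 + sB)
         = 2 * (fps2z C ^+ 2 * fps2t C ^+ 2) by ring: hB.
  apply: contra_eq_neq => ->; rewrite mul0r eq_sym.
  exact: mulf_neq0 two2 (mulf_neq0 (expf_neq0 2 zs0) (expf_neq0 2 ts0)).
pose E := (1 - fps2z C ^+ 2 * fps2t C ^+ 2 + sB) * (1 - fps2z C ^+ 2 + sA)
         + (1 + fps2z C ^+ 2 * fps2t C ^+ 2 - sB) * (1 + fps2z C ^+ 2 - sA).
(* In degree 0 in [z] the second product vanishes and the first is [2 * 2]. *)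
have E0 : E != 0.
  apply: neq0; rewrite fcoefD !fcoef0M !(fcoefD, fcoefN) !fcoef0M.
  by rewrite hA1 hB1 z0 !mul0r oppr0 !addr0 subrr mul0r addr0 mulf_neq0.
have row0 := walk_centre_eqs hA hA0 hB hB0 0.
have row1 := walk_centre_eqs hA hA0 hB hB0 1.
rewrite /= ?eqxx in row0 row1.
have w2 := fps2C_neq0 w0.
split.
- rewrite (ffrac_div (mulf_neq0 (mulf_neq0 (mulf_neq0 w2 c0) c'0) Dp0)
    (p_cleared hA hB E0 gp row0)) /z /t /A /B /sqrt2.
  move: (fps2z C) (fps2t C) (fps2C (sqrtC 2)) (sA) (sB) => z' t' w' A' B'.
  by rewrite !ffracE !ffrac1.
- rewrite (ffrac_div (mulf_neq0 (mulf_neq0 (mulf_neq0 two2 w2) c0) c'0)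
    (r_cleared hA hB E0 gr row0)) /z /t /A /B /sqrt2.
  move: (fps2z C) (fps2t C) (fps2C (sqrtC 2)) (sA) (sB) => z' t' w' A' B'.
  by rewrite !ffracE !ffrac1.
- rewrite (ffrac_div (mulf_neq0 (mulf_neq0 (mulf_neq0 (mulf_neq0 w2 c0) c'0) A0) Dq0)
    (q_cleared hA hB E0 gq row1)) /z /t /A /B /sqrt2.
  move: (fps2z C) (fps2t C) (fps2C (sqrtC 2)) (sA) (sB) => z' t' w' A' B'.
  by rewrite !ffracE !ffrac1.
- rewrite (ffrac_div
    (mulf_neq0 (mulf_neq0 (mulf_neq0 (mulf_neq0 (mulf_neq0 w2 c0) c'0) A0) Ds0)
       Dq0)
    (s_cleared hA hB E0 gs row1)) /z /t /A /B /sqrt2.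
  move: (fps2z C) (fps2t C) (fps2C (sqrtC 2)) (sA) (sB) => z' t' w' A' B'.
  by rewrite !ffracE !ffrac1.
Qed.

Theorem theorem3p1 (R : realType) (C : numClosedFieldType := R[i])
  (p q r s : nat -> nat -> C)
  (hPsi : forall n k : nat, (1 <= n)%N ->
    Psi C 0 n k = p n k *: Pmx C + q n k *: Qmx C
                     + r n k *: Rmx C + s n k *: Smx C)
  (sA sB : fps2 C)
  (hA : sA ^+ 2 = 1 + fps2z C ^+ 4)
  (hA0 : fps2_coef sA 0 0 = 1)
  (hB : sB ^+ 2 = 1 + fps2z C ^+ 4 * fps2t C ^+ 4)
  (hB0 : fps2_coef sB 0 0 = 1) :
  let z := ffrac (fps2z C) in
  let t := ffrac (fps2t C) in
  let A := ffrac sA in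
  let B := ffrac sB in
  let sqrt2 := ffrac (fps2C (sqrtC 2)) in
  [/\ ffrac (even_gf p) =
        (z ^+ 2 * t ^+ 2
         * (2 * (1 - t ^+ 2) * z ^+ 2 + (1 - z ^+ 2 * t ^+ 2) * A
            + (1 - z ^+ 2) * B))
        / (sqrt2 * (1 - z ^+ 2) * (1 - z ^+ 2 * t ^+ 2)
           * (- 1 + (1 + A) * t ^+ 2 + B)),
      ffrac (even_gf r) =
        (- (z ^+ 4) * t ^+ 2 + (1 + A) * (1 - B)
         + z ^+ 2 * (1 + (1 + A) * t ^+ 2 - B))
        / (2 * sqrt2 * (1 - z ^+ 2) * (1 - z ^+ 2 * t ^+ 2)),
      ffrac (even_gf q) =
        (z ^+ 2 * t ^+ 2
         * (- (z ^+ 4) + z ^+ 6 * t ^+ 2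
            + (1 + A) * (- 1 + (2 - t ^+ 2) * z ^+ 2 - (1 - z ^+ 2) * B)))
        / (sqrt2 * (1 - z ^+ 2) * (1 - z ^+ 2 * t ^+ 2) * (1 + A)
           * (1 - (1 - A) * t ^+ 2 + B))
    & ffrac (even_gf s) =
        (z ^+ 4 * t ^+ 2
         * ((1 - z ^+ 4 * t ^+ 4) * A
            + (1 - z ^+ 2) * (1 + z ^+ 2 * t ^+ 2) * B
            + (1 - z ^+ 2 * t ^+ 2) * A * B + (1 - z ^+ 2) * B ^+ 2))
        / (sqrt2 * (1 - z ^+ 2) * (1 - z ^+ 2 * t ^+ 2) * (1 + A)
           * (- 1 + z ^+ 2 * t ^+ 2 + B) * (1 - (1 - A) * t ^+ 2 + B))].
Proof. exact: even_gf_Hadamard. Qed.
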